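(* Let $d\in\mathbb{N}$ and let $D$ be a digraph with $\Delta^0(D)\leq d$ and $g(D)\geq 200d^2$ such that $\mathrm{ex}_D(v)\neq 0$ for all $v\in V(D)$. Then $D$ is consistent.
   Context: A digraph is finite, has no loops and, between two distinct vertices, at most one edge in each direction. $\Delta^0(D)=\max_{v}\max\{d^+(v),d^-(v)\}$. The girth $g(D)$ is the length of a shortest directed cycle in $D$ (infinite if $D$ has no directed cycle). For $v\in V(D)$, $\mathrm{ex}_D(v)=|d^+_D(v)-d^-_D(v)|$, and $\mathrm{ex}(D)=\frac12\sum_v \mathrm{ex}_D(v)$. $D$ is consistent if its edge set can be partitioned into exactly $\mathrm{ex}(D)$ directed paths. *)

(* Defs.v *)
From mathcomp Require Import all_boot all_order all_algebra.
Set Implicit Arguments.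
Unset Strict Implicit.
Unset Printing Implicit Defensive.

(* A digraph on the finite vertex type T is an irreflexive e : rel T;         *)
(* e u v says that there is an edge from u to v.                              *)

Section Digraph.
Variables (T : finType) (e : rel T).

Definition edges : {set T * T} := [set uv | e uv.1 uv.2].

Definition outdeg (v : T) : nat := #|[set w | e v w]|.
Definition indeg (v : T) : nat := #|[set u | e u v]|.

Definition Delta0 : nat := \max_(v : T) maxn (outdeg v) (indeg v).

Definition dicycle (c : seq T) : bool := (0 < size c) && ucycleb e c.

Definition has_dicycle (n : nat) : bool := [exists c : n.-tuple T, dicycle c].

(* None stands for infinite girth. A directed cycle has at most #|T| vertices,*)
(* so the search range is exhaustive (girth_NoneP, girth_SomeP).              *)
Definition girth : option nat := ohead [seq n <- iota 0 #|T|.+1 | has_dicycle n].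

Definition girth_ge (k : nat) : bool :=
  if girth is Some g then k <= g else true.

Definition exv (v : T) : nat := `|outdeg v - indeg v|%N.

(* The sum is always even, so the halving is exact (exDK).                    *)
Definition exD : nat := (\sum_(v : T) exv v)./2.

Definition dipath (p : seq T) : bool := uniq p && sorted e p.

Definition path_edges (p : seq T) : {set T * T} := [set:: zip p (behead p)].

(* partition excludes the empty block, so every path has at least one edge.   *)
Definition consistent : Prop :=
  exists P : {set {set T * T}},
    [/\ partition P edges,
        forall A, A \in P -> exists p : seq T, dipath p /\ A = path_edges p
      & #|P| = exD].

Lemma has_dicycleP n :
  reflect (exists c, dicycle c /\ size c = n) (has_dicycle n).
Proof.
apply: (iffP existsP) => [[c cP]|[c [cP <-]]].
  by exists c; rewrite size_tuple.
by exists (in_tuple c).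
Qed.

Lemma dicycle_size c : dicycle c -> size c <= #|T|.
Proof. by case/and3P=> _ _ /card_uniqP <-; apply: max_card. Qed.

Lemma girth_NoneP : girth = None <-> forall c, ~~ dicycle c.
Proof.
rewrite /girth; split=> [|noC]; last first.
  suff -> : [seq n <- iota 0 #|T|.+1 | has_dicycle n] = [::] by [].
  apply/eqP; rewrite -[_ == _]negbK -has_filter; apply/hasPn => n _.
  by apply/has_dicycleP => -[c [cP _]]; move: (noC c); rewrite cP.
case E: (filter _ _) => // _ c; apply/negP => cP.
have : size c \in [seq n <- iota 0 #|T|.+1 | has_dicycle n].
  rewrite mem_filter mem_iota add0n /= ltnS dicycle_size // andbT.
  by apply/has_dicycleP; exists c.
by rewrite E.
Qed.

Lemma girth_SomeP g : girth = Some g <->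
  (exists c, dicycle c /\ size c = g) /\ (forall c, dicycle c -> g <= size c).
Proof.
have some_min h : girth = Some h ->
  (exists c, dicycle c /\ size c = h) /\ (forall c, dicycle c -> h <= size c).
  rewrite /girth; set s := filter _ _ => Es.
  have srt : sorted leq s.
    by apply: sorted_filter (iota_sorted _ _); exact: leq_trans.
  have mem c : dicycle c -> size c \in s.
    move=> cP; rewrite mem_filter mem_iota add0n /= ltnS dicycle_size // andbT.
    by apply/has_dicycleP; exists c.
  have : h \in s by case: s Es {srt mem} => //= a s [->]; rewrite mem_head.
  rewrite mem_filter => /andP[/has_dicycleP hc _]; split=> // c /mem.
  case: s Es srt {mem} => //= a s [->] /(order_path_min leq_trans) /allP le_h.
  by rewrite inE => /predU1P[-> //|/le_h].
split=> [/some_min //|[[c [cP <-]] gmin]].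
case E: girth => [h|]; last by move/girth_NoneP: E => /(_ c); rewrite cP.
have [[c' [c'P <-]] hmin] := some_min _ E.
by congr Some; apply/eqP; rewrite eqn_leq hmin // gmin.
Qed.

Lemma sum_outdeg : \sum_v outdeg v = \sum_v indeg v.
Proof.
rewrite /outdeg /indeg.
under eq_bigr do rewrite -sum1dep_card big_mkcond.
rewrite exchange_big /=; apply: eq_bigr => v _.
by rewrite -sum1dep_card [RHS]big_mkcond.
Qed.

Lemma exDK : exD.*2 = \sum_v exv v.
Proof.
have odd_exv v : odd (exv v) = odd (outdeg v + indeg v).
  rewrite /exv; case: (leqP (outdeg v) (indeg v)) => [le|/ltnW le].
    by rewrite distnC distnEl // oddB // oddD addbC.
  by rewrite distnEl // oddB // oddD.
have odd_sum (F G : T -> nat) : (forall v, odd (F v) = odd (G v)) ->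
    odd (\sum_v F v) = odd (\sum_v G v).
  move=> FG; elim/big_rec2: _ => // v a b _ ab.
  by rewrite !oddD FG ab.
rewrite /exD -[RHS]odd_double_half (odd_sum _ _ odd_exv) big_split /=.
by rewrite sum_outdeg addnn odd_double.
Qed.

End Digraph.

(* Main.v *)
Require Import Defs.
From mathcomp Require Import all_boot all_order all_algebra.
From mathcomp Require Import ring lra.
Set Implicit Arguments.
Unset Strict Implicit.
Unset Printing Implicit Defensive.
Import Order.TTheory GRing.Theory Num.Theory.

(* At every vertex v match the in-edges to the out-edges so that the smaller  *)
(* side is saturated. Consecutive matched edges form ex(D) open trails, plus  *)
(* possibly closed ones; the matchings solve the problem as soon as no        *)
(* directed cycle is followed at all its vertices but one. Choose each        *)
(* matching as a random cyclic shift, so that a given in-edge meets a given   *)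
(* out-edge with probability 1/M(v), M = max(d+, d-). Since d+ and d- differ, *)
(* 1/M^2 <= (1 - 1/d) / (d+ d-), hence the product of 1/M along a cycle of    *)
(* length l is at most (1 - 1/d)^(l/2) times the sum of the probabilities     *)
(* that the forward and the backward simple random walks trace it. The cycles *)
(* of length l through v thus have total weight at most 2l(1 - 1/d)^(l/2),    *)
(* and, all cycles being long, Rosenfeld's counting form of the local lemma   *)
(* yields matchings that follow no cycle.                                     *)

(** * Path decompositions from matchings *)

(** [pairing_consistent] is the combinatorial half. A trail of matched edges that repeated a vertex
    would contain a directed cycle obeying the matchings everywhere except perhaps where it closes
    up. If no such cycle exists, all trails are paths, and there is one for each edge without
    predecessor; since the smaller side is saturated at each vertex, these edges number the sum of
    the positive parts of d+ - d-, which is ex(D).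

    [exists_good_shift] finds the matchings through [exists_avoiding], with one bad event per
    directed cycle and choice of its exempt vertex. Put r = 1 - 1/(4d), so that r^4 >= 1 - 1/d. The
    bad event of a cycle has probability at most d times the product of the 1/M ([bad_weight_le]),
    and these products sum to at most 2 l r^(2l) over the cycles of length l through a vertex
    ([sum_cycle_weight_through]). One factor r^l pays for the r^-l of the local lemma; what remains
    is the sum of 2 d l r^l over l >= 200 d^2, which is at most 1 - r because r^(4d) <= 1/2
    ([tail_bound]). *)

Lemma exD_sum_subn (T : finType) (e : rel T) :
  \sum_v (outdeg e v - indeg e v) = exD e.
Proof.
have sumE : \sum_v (outdeg e v - indeg e v) = \sum_v (indeg e v - outdeg e v).
  apply: (@addIn (\sum_v indeg e v)); rewrite -[X in _ = _ + X]sum_outdeg.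
  rewrite -!big_split /=; apply: eq_bigr => v _.
  by rewrite addnC -maxnE addnC -maxnE maxnC.
apply: double_inj; rewrite exDK -addnn [X in _ + X]sumE -big_split /=.
apply: eq_bigr => v _; rewrite /exv.
case: (leqP (outdeg e v) (indeg e v)) => [le|/ltnW le].
  by rewrite distnC distnEl // (eqP le).
by rewrite distnEl // (eqP le) addn0.
Qed.

Section Decomposition.
Variables (T : finType) (e : rel T).

(* [pr v u w] says that the edges [u v] and [v w] are consecutive on a path.  *)
Variable pr : T -> rel T.

Hypothesis pr_edge : forall v u w, pr v u w -> e u v && e v w.
Hypothesis pr_fun : forall v u w w', pr v u w -> pr v u w' -> w = w'.
Hypothesis pr_inj : forall v u u' w, pr v u w -> pr v u' w -> u = u'.
Hypothesis pr_in : forall v u,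
  indeg e v <= outdeg e v -> e u v -> exists w, pr v u w.
Hypothesis pr_out : forall v w,
  outdeg e v <= indeg e v -> e v w -> exists u, pr v u w.

Definition succ_edge : rel (T * T) :=
  fun a b => (a.2 == b.1) && pr a.2 a.1 b.2.

Hypothesis e_irr : irreflexive e.
Hypothesis no_closed_trail : forall c, dicycle e c ->
  ~ forall u, u \in behead c -> pr u (prev c u) (next c u).

Let E := edges e.
Let R := succ_edge.

Definition start_edge (b : T * T) := e b.1 b.2 && [forall a, ~~ R a b].
(** The default [b] makes start edges fixed points, so iterating too often in [first_edge] does no
    harm. *)
Definition pred_edge (b : T * T) := odflt b [pick a | R a b].
Definition first_edge (b : T * T) := iter #|T| pred_edge b.

Lemma succ_edgeE a b : R a b -> e a.1 a.2 && e b.1 b.2.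
Proof. by case/andP=> /eqP <- /pr_edge. Qed.

Lemma succ_edge_inj a a' b : R a b -> R a' b -> a = a'.
Proof.
case: a a' b => [u v] [u' v'] [x w] /andP[/= /eqP -> p] /andP[/= /eqP -> p'].
by rewrite (pr_inj p p').
Qed.

Lemma succ_edge_fun a b b' : R a b -> R a b' -> b = b'.
Proof.
case: a b b' => [u v] [x w] [x' w'] /andP[/= /eqP <- p] /andP[/= /eqP <- p'].
by rewrite (pr_fun p p').
Qed.

Lemma pred_edgeE a b : R a b -> pred_edge b = a.
Proof.
rewrite /pred_edge => Rab; case: pickP => [c Rcb|/(_ a)]; last by rewrite Rab.
exact: succ_edge_inj Rcb Rab.
Qed.

Lemma pred_edge_start s : start_edge s -> pred_edge s = s.
Proof.
case/andP=> _ /forallP no_pred; rewrite /pred_edge.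
by case: pickP => // a; rewrite (negPf (no_pred a)).
Qed.

Lemma first_edge_start s : start_edge s -> first_edge s = s.
Proof.
move=> sS; rewrite /first_edge; elim: #|T| => //= n ->.
exact: pred_edge_start.
Qed.

Lemma trail_edges a q : e a.1 a.2 -> path R a q -> all (fun b => e b.1 b.2) q.
Proof.
elim: q a => //= b q IHq a _ /andP[/succ_edgeE/andP[_ eb] /(IHq _ eb) ->].
by rewrite eb.
Qed.

Lemma trail_sorted s q : e s.1 s.2 -> path R s q ->
  sorted e [:: s.1, s.2 & map snd q].
Proof.
move=> /= -> /=.
elim: q s => //= c q IHq s /andP[/[dup] Rsc /andP[/eqP -> _] /IHq ->].
by case/andP: (succ_edgeE Rsc) => _ ->.
Qed.

Lemma trail_nth x0 a q i : path R a q -> i < size q ->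
  pr (nth x0 (a.2 :: map snd q) i) (nth x0 [:: a.1, a.2 & map snd q] i)
     (nth x0 (map snd q) i).
Proof.
elim: q a i => //= b q IHq a [|i] /andP[/andP[/eqP ab p] bq] /= ltiq.
  exact: p.
by rewrite ab; apply: IHq bq ltiq.
Qed.

(** By induction only the first vertex could recur. The segment up to its first recurrence would be
    a directed cycle matched at every vertex but its head, where the trail begins and no pairing is
    known; hence the [behead] in [no_closed_trail]. *)
Lemma trail_uniq a q :
  e a.1 a.2 -> path R a q -> uniq [:: a.1, a.2 & map snd q].
Proof.
elim: q a => [|b q IHq] a ea aq.
  by rewrite /= inE andbT; case: eqP ea => // ->; rewrite e_irr.
have /andP[Rab bq] := aq; have /andP[_ eb] := succ_edgeE Rab.
have ab : a.2 = b.1 by case/andP: Rab => /eqP.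
have Up : uniq (a.2 :: map snd (b :: q)) by rewrite ab; apply: IHq.
rewrite cons_uniq Up andbT; apply/negP => xp.
have ep := trail_sorted ea aq; have pP i := trail_nth a.1 (i := i) aq.
set x := a.1 in xp ep pP; have {}ep : path e x (a.2 :: map snd (b :: q)) by [].
rewrite -[map snd (b :: q)]/(behead (a.2 :: map snd (b :: q))) in pP.
have szp : size (a.2 :: map snd (b :: q)) = (size (b :: q)).+1 by rewrite /= size_map.
move: (a.2 :: map snd (b :: q)) szp xp Up ep pP => p szp xp Up ep pP.
case/splitPr: xp szp Up ep pP => p1 p2 szp Up ep pP.
have Uc : uniq (x :: p1).
  by move: Up; rewrite -cat_rcons cat_uniq rcons_uniq => /andP[].
have ec : cycle e (x :: p1).
  by move: ep; rewrite -cat_rcons cat_path => /andP[].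
apply: (@no_closed_trail (x :: p1)); first by rewrite /dicycle /= /ucycleb ec.
move=> u; rewrite [behead _]/= => up1; have xu : x != u.
  by apply: contraTneq up1 => <-; case/andP: Uc.
rewrite next_nth prev_nth !inE up1 orbT /= (negPf xu).
have lti : index u p1 < size p1 by rewrite index_mem.
have ltq : index u p1 < size (b :: q).
  by rewrite -ltnS -szp size_cat /= addnS ltnS (leq_trans lti) ?leq_addr.
have := pP _ ltq; rewrite nth_behead -cat_cons !nth_cat lti nth_index //.
have -> : index u p1 < size (x :: p1) by rewrite ltnS ltnW.
(* At the last vertex of [p1], [next] wraps around to [x], which is also the vertex that follows
   [p1] on the trail. *)
case: ltnP => // ge; rewrite (nth_default x ge).
have /eqP -> : (index u p1).+1 == size p1 by rewrite eqn_leq lti.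
by rewrite subnn.
Qed.

Lemma trail_size a q : e a.1 a.2 -> path R a q -> size q < #|T|.
Proof.
move=> ea /(trail_uniq ea) /card_uniqP /= cardE.
have := max_card [in [:: a.1, a.2 & map snd q]].
by rewrite cardE size_map; apply: leq_trans.
Qed.

(** Tracing back from [b] either stops at a start edge or gives a trail with [n] further edges;
    [trail_size] rules out the latter for [n = #|T|]. *)
Lemma iter_pred_edgeP n b : e b.1 b.2 -> exists q,
  [/\ e (iter n pred_edge b).1 (iter n pred_edge b).2,
      path R (iter n pred_edge b) q, last (iter n pred_edge b) q = b
    & start_edge (iter n pred_edge b) \/ size q = n].
Proof.
move=> eb; elim: n => [|n [q [ea aq aqb st]]] /=.
  by exists [::]; split=> //; right.
set a := iter n pred_edge b in ea aq aqb st *.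
have [aS|] := boolP (start_edge a).
  by exists q; rewrite pred_edge_start //; split=> //; left.
rewrite /start_edge ea negb_forall => /existsP[c]; rewrite negbK => Rca.
rewrite (pred_edgeE Rca); exists (a :: q).
rewrite /= Rca aq; case/andP: (succ_edgeE Rca) => -> _; split=> //.
case: st => [/andP[_ /forallP/(_ c)]|->]; by [rewrite Rca | right].
Qed.

Lemma first_edgeP b : e b.1 b.2 ->
  start_edge (first_edge b) /\
  exists2 q, path R (first_edge b) q & last (first_edge b) q = b.
Proof.
case/(iter_pred_edgeP #|T|)=> q [ea aq aqb st]; split; last by exists q.
by case: st => // sq; have := trail_size ea aq; rewrite sq ltnn.
Qed.

Lemma first_edge_succ a b : R a b -> first_edge b = first_edge a.
Proof.
move=> Rab; have /andP[_ eb] := succ_edgeE Rab.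
have [bS _] := first_edgeP eb.
rewrite -(pred_edge_start bS) /first_edge -iterS iterSr.
by rewrite (pred_edgeE Rab).
Qed.

Lemma first_edge_trail a q b : path R a q -> b \in a :: q ->
  first_edge b = first_edge a.
Proof.
elim: q a => [|c q IHq] a /=; first by rewrite inE => _ /eqP ->.
case/andP=> Rac cq; rewrite inE => /predU1P[-> //|/(IHq _ cq) ->].
exact: first_edge_succ.
Qed.

Lemma maximal_trail s : e s.1 s.2 ->
  exists2 q, path R s q & forall b, ~~ R (last s q) b.
Proof.
move=> es; suff H n : exists2 q, path R s q &
    (forall b, ~~ R (last s q) b) \/ size q = n.
  case: (H #|T|) => q sq [qmax|szq]; first by exists q.
  by have := trail_size es sq; rewrite szq ltnn.
elim: n => [|n [q sq [qmax|szq]]]; first by exists [::] => //; right.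
  by exists q => //; left.
have [qmax|] := boolP [forall b, ~~ R (last s q) b].
  by exists q => //; left; apply/forallP.
rewrite negb_forall => /existsP[c]; rewrite negbK => Rc.
by exists (rcons q c); [rewrite rcons_path sq | right; rewrite size_rcons szq].
Qed.

(** Successors are unique, so every trail from [s] is a prefix of the maximal one. *)
Lemma trail_sub_maximal s q q' : path R s q -> (forall b, ~~ R (last s q) b) ->
  path R s q' -> last s q' \in s :: q.
Proof.
elim: q' s q => [|c q' IHq] s q sq qmax /=; first by rewrite mem_head.
case/andP=> Rsc cq'; case: q sq qmax => [_ /(_ c)|c' q /=]; first by rewrite /= Rsc.
case/andP=> Rsc' c'q qmax; rewrite -(succ_edge_fun Rsc Rsc') in c'q qmax *.
by rewrite inE IHq ?orbT.
Qed.

Lemma zip_trail s q : path R s q ->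
  zip [:: s.1, s.2 & map snd q] (s.2 :: map snd q) = s :: q.
Proof.
rewrite /= -surjective_pairing => sq; congr (_ :: _).
elim: q s sq => //= c q IHq s /andP[/andP[/eqP -> _] /IHq ->].
by rewrite -surjective_pairing.
Qed.

Definition fiber_edge s := [set b in E | first_edge b == s].

Lemma fiber_edgeP s : start_edge s ->
  exists p, dipath e p /\ fiber_edge s = path_edges p.
Proof.
move=> sS; have /andP[es _] := sS.
have [q sq qmax] := maximal_trail es.
exists [:: s.1, s.2 & map snd q]; split.
  by rewrite /dipath trail_uniq ?trail_sorted.
rewrite /path_edges [behead _]/= zip_trail //; apply/setP=> b.
rewrite !inE -[(b == s) || _]in_cons; apply/andP/idP => [[eb /eqP fb]|bq].
  have [_ [q' bq' <-]] := first_edgeP eb.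
  by rewrite fb in bq' *; apply: trail_sub_maximal bq'.
rewrite (first_edge_trail sq bq) first_edge_start // eqxx; split=> //.
move: bq; rewrite inE => /predU1P[-> //|bq].
exact: (allP (trail_edges es sq)).
Qed.

(** If d+ <= d-, every out-edge has a predecessor. Otherwise the matching embeds the in-edges into
    the out-edges, and the start edges at [v] are those outside the image. *)
Lemma card_start_edge_at v :
  #|[set w | start_edge (v, w)]| = outdeg e v - indeg e v.
Proof.
have [le|/ltnW le] := leqP (outdeg e v) (indeg e v).
  rewrite (eqP le) -(cards0 T); congr #|pred_of_set _|; apply/setP => w.
  rewrite !inE; apply/negP => /andP[/= evw /forallP no_pred].
  have [u puw] := pr_out le evw.
  by move/negP: (no_pred (u, v)); apply; rewrite /R /succ_edge /= eqxx.
pose f u := odflt u [pick w | pr v u w].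
have fP u : e u v -> pr v u (f u).
  move=> /(pr_in le) [w pw]; rewrite /f.
  by case: pickP => [//|/(_ w)]; rewrite pw.
have fI : {in [set u | e u v] &, injective f}.
  move=> u u'; rewrite !inE => /fP p /fP p' fE.
  by rewrite fE in p; apply: pr_inj p p'.
rewrite /outdeg /indeg -(card_in_imset fI).
have sub : f @: [set u | e u v] \subset [set w | e v w].
  apply/subsetP => w /imsetP[u]; rewrite !inE => /fP /pr_edge /andP[_ ef] ->.
  exact: ef.
rewrite -(setIidPr sub) -cardsD; congr #|pred_of_set _|; apply/setP=> w.
rewrite !inE /start_edge /= [RHS]andbC; congr (_ && _).
apply/forallP/negP => [no_pred /imsetP[u]|nf [u x]].
  rewrite inE => /fP p wE; move/negP: (no_pred (u, v)); apply.
  by rewrite /R /succ_edge /= eqxx wE.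
apply/negP => /andP[/= /eqP -> p]; apply: nf; apply/imsetP; exists u.
  by rewrite inE; case/andP: (pr_edge p).
have /andP[euv _] := pr_edge p.
exact: pr_fun p (fP u euv).
Qed.

Lemma card_start_edge : #|[set s | start_edge s]| = exD e.
Proof.
rewrite -exD_sum_subn -sum1_card.
rewrite (eq_bigl (fun s : T * T => xpredT s.1 && start_edge (s.1, s.2))).
  rewrite -(pair_big_dep xpredT (fun v w => start_edge (v, w)) (fun _ _ => 1)).
  by apply: eq_bigr => v _; rewrite sum1dep_card card_start_edge_at.
by case=> v w; rewrite inE.
Qed.

Lemma pairing_consistent : consistent e.
Proof.
have startP s : start_edge s -> s \in fiber_edge s.
  by move=> sS; rewrite !inE first_edge_start // eqxx andbT; case/andP: sS.
exists (fiber_edge @: [set s | start_edge s]); split.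
- apply/and3P; split.
  + rewrite /cover; apply/eqP/setP=> b; apply/bigcupP/idP.
      by case=> A /imsetP[s _ AE]; rewrite AE inE => /andP[].
    rewrite inE => eb; have [bS _] := first_edgeP eb.
    exists (fiber_edge (first_edge b)); last by rewrite !inE eb eqxx.
    by apply: imset_f; rewrite inE.
  + apply/trivIsetP => A B /imsetP[s _ ->] /imsetP[t _ ->] neq.
    apply/pred0P => b /=; apply/negP => /andP[].
    rewrite !inE => /andP[_ /eqP bs] /andP[_ /eqP bt].
    by move: neq; rewrite -bs -bt eqxx.
  + apply/negP => /imsetP[s sS fE]; rewrite inE in sS.
    by have := startP s sS; rewrite -fE inE.
- by move=> A /imsetP[s]; rewrite inE => sS ->; apply: fiber_edgeP.
- rewrite card_in_imset ?card_start_edge // => s t.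
  rewrite !inE => _ tS fE; have := startP t tS.
  by rewrite -fE inE first_edge_start // => /andP[_ /eqP].
Qed.

End Decomposition.

(** * A counting form of the local lemma *)

Lemma card_bigcup_seq_le (J : eqType) (U : finType) (t : seq J) (P : pred J)
    (F : J -> {set U}) :
  #|\bigcup_(i <- t | P i) F i| <= \sum_(i <- t | P i) #|F i|.
Proof.
elim/big_rec2: _ => [|i n D _ le]; first by rewrite cards0.
by apply: leq_trans (leq_card_setU _ _) _; rewrite leq_add2l.
Qed.

Section Resample.
Variables (T X : finType).
Implicit Types (w : {ffun T -> X}) (Q : pred {ffun T -> X}).

Definition upd w u x : {ffun T -> X} :=
  [ffun t => if t == u then x else w t].

Lemma updE w u x : upd w u x u = x.
Proof. by rewrite ffunE eqxx. Qed.

Lemma upd_id w u : upd w u (w u) = w.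
Proof. by apply/ffunP => t; rewrite ffunE; case: eqP => [->|]. Qed.

Lemma upd_upd w u x y : upd (upd w u x) u y = upd w u y.
Proof. by apply/ffunP => t; rewrite !ffunE; case: eqP. Qed.

(** Independence by counting: swapping the value at [u] with the extra letter [x] is injective and
    preserves [Q]. *)
Lemma card_indep1 Q u (A : {set X}) :
    (forall w x, Q (upd w u x) = Q w) ->
  #|[set w | Q w & w u \in A]| * #|X| <= #|A| * #|[set w | Q w]|.
Proof.
move=> Qu; rewrite -[#|X|]cardsT -!cardsX.
pose h (z : {ffun T -> X} * X) := (z.1 u, upd z.1 u z.2).
rewrite -(card_imset _ (_ : injective h)) => [|[w x] [w' x'] [/= wE updwE]].
  apply: subset_leq_card; apply/subsetP => _ /imsetP[[w x] /[!inE] /= wP ->].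
  by rewrite Qu; case/andP: wP => /andP[-> ->].
have xE : x = x' by rewrite -[x](updE w u) updwE updE.
by rewrite -[w](upd_id w u) -[w'](upd_id w' u) -(upd_upd w u x) updwE wE upd_upd xE.
Qed.

Lemma card_indep Q (C : {set T}) (A : T -> {set X}) :
    (forall u w x, u \in C -> Q (upd w u x) = Q w) ->
  #|[set w | Q w & [forall u in C, w u \in A u]]| * #|X| ^ #|C| <=
  (\prod_(u in C) #|A u|) * #|[set w | Q w]|.
Proof.
elim: {C}#|C| {-2}C (erefl #|C|) Q => [|n IHn] C cardC Q QC.
  rewrite (cards0_eq cardC) big_set0 cards0 mul1n muln1; apply: subset_leq_card.
  by apply/subsetP => w; rewrite !inE => /andP[].
have /card_gt0P[u uC] : 0 < #|C| by rewrite cardC.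
have cardC' : #|C :\ u| = n by apply/eqP; rewrite -eqSS -cardC (cardsD1 u C) uC.
have QC' v w x : v \in C :\ u -> Q (upd w v x) = Q w.
  by case/setD1P=> _ /QC ->.
have le2 := IHn _ cardC' _ QC'; rewrite cardC' in le2.
rewrite (big_setD1 u) //=.
pose Q' w := Q w && [forall v in C :\ u, w v \in A v].
have Q'u w x : Q' (upd w u x) = Q' w.
  rewrite /Q' QC //; congr (_ && _); apply: eq_forallb_in => v.
  by case/setD1P=> vu _; rewrite ffunE (negPf vu).
have setE : [set w | Q w & [forall v in C, w v \in A v]] =
            [set w | Q' w & w u \in A u].
  apply/setP => w; rewrite !inE /Q' -andbA; congr (_ && _).
  apply/forall_inP/andP => [H|[/forall_inP H Hu] v vC].
    by split; [apply/forall_inP => v /setD1P[_ /H]|apply: H].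
  by have [-> //|vu] := eqVneq v u; apply: H; rewrite !inE vu.
have := card_indep1 (A u) Q'u; rewrite -setE cardC expnS mulnA => le1.
apply: leq_trans (leq_mul le1 (leqnn _)) _.
by rewrite -mulnA -[X in _ <= X]mulnA leq_mul2l le2 orbT.
Qed.

End Resample.

Local Open Scope ring_scope.

Section LocalAvoidance.
Variables (R : realFieldType) (T X : finType) (I : eqType) (s : seq I).
Variables (C : I -> {set T}) (A : I -> T -> {set X}) (r : R).

Definition occurs (B : I) (w : {ffun T -> X}) := [forall u in C B, w u \in A B u].
Definition event_weight B : R := \prod_(u in C B) (#|A B u|%:R / #|X|%:R).

Hypothesis X_gt0 : (0 < #|X|)%N.
Hypothesis r_gt0 : 0 < r.
Hypothesis C_neq0 : forall B, B \in s -> C B != set0.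
Hypothesis local_sum : forall v,
  \sum_(B <- s | v \in C B) event_weight B * r ^- #|C B| <= 1 - r.

Definition avoids (S : {set T}) : pred {ffun T -> X} :=
  fun w => all (fun B => (C B \subset S) ==> ~~ occurs B w) s.
Definition avoiding S : R := #|[set w | avoids S w]|%:R.

Lemma avoids_sub (S S' : {set T}) w : S \subset S' -> avoids S' w -> avoids S w.
Proof.
move=> sSS /allP aw; apply/allP => B /aw; apply: contraTT.
rewrite !negb_imply => /andP[CS ->]; rewrite andbT.
exact: subset_trans CS sSS.
Qed.

Lemma avoids_upd (S : {set T}) u w x : u \notin S -> avoids S (upd w u x) = avoids S w.
Proof.
move=> uS; apply: eq_in_all => B _; case CS: (C B \subset S) => //=.
congr (~~ _); apply: eq_forallb_in => v vC; rewrite ffunE.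
by case: eqP uS => // <-; rewrite (subsetP CS).
Qed.

Lemma card_occurs_avoids (S : {set T}) B : [disjoint S & C B] ->
  #|[set w | avoids S w & occurs B w]|%:R <= event_weight B * avoiding S.
Proof.
move=> dSC; rewrite /event_weight /avoiding.
have := @card_indep T X (avoids S) (C B) (A B) => /(_ _)/wrap[] => [u w x uC|].
  by apply: avoids_upd; rewrite (disjointFl dSC).
rewrite -(ler_nat R) !natrM natrX natr_prod => le.
rewrite big_split /= prodfV prodr_const mulrAC ler_pdivlMr //.
by rewrite exprn_gt0 // ltr0n.
Qed.

Lemma event_weight_ge0 B : 0 <= event_weight B.
Proof. by apply: prodr_ge0 => u _; rewrite mulr_ge0 // invr_ge0. Qed.

Lemma r_le1 : T -> r <= 1.
Proof.
move=> v; rewrite -subr_ge0; apply: le_trans (local_sum v).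
apply: sumr_ge0 => B _; rewrite mulr_ge0 ?event_weight_ge0 //.
by rewrite invr_ge0 exprn_ge0 // ltW.
Qed.

(** Union bound: an assignment lost in passing from [S] to [v |: S] realises an event whose support
    contains [v]. Avoidance is weakened to [S :\: C B] to make it independent of that event. *)
Lemma avoiding_split (S : {set T}) v :
  avoiding S <= avoiding (v |: S) +
    \sum_(B <- s | v \in C B) #|[set w | avoids (S :\: C B) w & occurs B w]|%:R.
Proof.
rewrite /avoiding -natr_sum -natrD ler_nat.
apply: leq_trans (leq_add (leqnn _) (card_bigcup_seq_le _ _ _)).
apply: leq_trans (leq_card_setU _ _); apply: subset_leq_card.
apply/subsetP => w; rewrite !inE => wS.
have [//|] := boolP (avoids _ w) => /allPn[B Bs].
rewrite negb_imply negbK => /andP[CvS occ].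
have vC : v \in C B.
  apply: contraT => vC; move/allP: wS => /(_ B Bs); rewrite occ implybF => /negP[].
  apply/subsetP => u uC; have := subsetP CvS u uC; rewrite !inE.
  by case: eqP uC => // ->; rewrite (negPf vC).
rewrite (big_rem B Bs) /= vC !inE occ (avoids_sub _ wS) ?subsetDl //.
Qed.

(* Rosenfeld's counting argument: a new event, supported on [C B], is         *)
(* independent of the avoidance of the events inside [S :\: C B], and by      *)
(* induction [avoiding (S :\: C B)] is at most [r ^- #|C B| * avoiding S].    *)
Lemma avoiding_step (S : {set T}) v : v \notin S -> r * avoiding S <= avoiding (v |: S).
Proof.
elim: {S}#|S|.+1 {-2}S v (ltnSn #|S|) => // n IHn S v; rewrite ltnS => leSn vS.
have av_ge0 S' : 0 <= avoiding S' by [].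
(* The induction hypothesis, applied to the elements of [D] one by one, costs a factor [r] each. *)
have chain (D S' : {set T}) : [disjoint S' & D] -> (#|S' :|: D| <= n)%N ->
    r ^+ #|D| * avoiding S' <= avoiding (S' :|: D).
  elim: {D}#|D| {-2}D (erefl #|D|) => [|k IHk] D cardD.
    by rewrite (cards0_eq cardD) setU0 cards0 mul1r.
  have /card_gt0P[u uD] : (0 < #|D|)%N by rewrite cardD.
  have cardD' : #|D :\ u| = k by apply/eqP; rewrite -eqSS -cardD (cardsD1 u D) uD.
  move=> dis; have uS' : u \notin S' by rewrite (disjointFl dis).
  have -> : S' :|: D = u |: (S' :|: (D :\ u)) by rewrite setUCA setD1K.
  have uSD : u \notin S' :|: (D :\ u) by rewrite !inE eqxx (negPf uS').
  rewrite cardsU1 uSD add1n => ltn.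
  apply: le_trans (IHn _ _ ltn uSD); rewrite cardD exprS -mulrA ler_pM2l // -cardD'.
  apply: IHk => //; last exact: ltnW.
  exact: disjointWr (subsetDl _ _) dis.
have := avoiding_split S v; rewrite -lerBlDr; apply: le_trans.
rewrite lerBrDl -lerBrDr -[X in X - _]mul1r -mulrBl.
apply: le_trans (ler_wpM2r (av_ge0 S) (local_sum v)); rewrite mulr_suml.
apply: ler_sum => B _.
apply: le_trans (card_occurs_avoids _) _; first by rewrite disjoints_subset subsetDr.
rewrite -mulrA ler_wpM2l ?event_weight_ge0 // mulrC ler_pdivlMr ?exprn_gt0 //.
have := chain (S :&: C B) (S :\: C B); rewrite setUC setID => le.
rewrite mulrC; apply: le_trans (le _ leSn); last first.
  rewrite disjoint_sym disjoints_subset; apply/subsetP => u; rewrite !inE.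
  by case/andP=> _ ->.
apply: ler_wpM2r => //; apply: ler_wiXn2l; rewrite ?r_le1 ?ltW //.
by rewrite subset_leq_card // subsetIr.
Qed.

Lemma exists_avoiding : exists w, forall B, B \in s -> ~~ occurs B w.
Proof.
have pos S : 0 < avoiding S.
  elim: {S}#|S| {-2}S (erefl #|S|) => [|n IHn] S cardS.
    (* Supports are nonempty, so over the empty set every assignment avoids everything. *)
    rewrite (cards0_eq cardS) ltr0n; apply/card_gt0P.
    have /card_gt0P[x _] := X_gt0; exists [ffun=> x].
    by rewrite inE; apply/allP => B /C_neq0; rewrite subset0 => /negPf ->.
  have /card_gt0P[u uS] : (0 < #|S|)%N by rewrite cardS.
  rewrite -(setD1K uS); apply: lt_le_trans (avoiding_step _); last by rewrite !inE eqxx.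
  rewrite mulr_gt0 // IHn //.
  by apply/eqP; rewrite -eqSS -cardS (cardsD1 u S) uS.
have := pos setT; rewrite ltr0n => /card_gt0P[w]; rewrite inE => /allP aw.
by exists w => B /aw; rewrite subsetT.
Qed.

End LocalAvoidance.

Local Close Scope ring_scope.

(** * Cyclic shift matchings *)

Definition maxdeg (T : finType) (e : rel T) v := maxn (outdeg e v) (indeg e v).

Section ShiftPairing.
Variables (T : finType) (e : rel T).
Implicit Types (u v w : T) (k : nat).
Notation M := (maxdeg e).

Definition in_nbrs v := enum [set u | e u v].
Definition out_nbrs v := enum [set w | e v w].

Lemma index_in_nbrs u v : e u v -> index u (in_nbrs v) < indeg e v.
Proof. by move=> euv; rewrite /indeg cardE index_mem mem_enum inE. Qed.

Lemma index_out_nbrs v w : e v w -> index w (out_nbrs v) < outdeg e v.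
Proof. by move=> evw; rewrite /outdeg cardE index_mem mem_enum inE. Qed.

Lemma nth_in_nbrs x v i : i < indeg e v ->
  e (nth x (in_nbrs v) i) v /\ index (nth x (in_nbrs v) i) (in_nbrs v) = i.
Proof.
rewrite /indeg cardE => lti; rewrite index_uniq ?enum_uniq //; split=> //.
by have := mem_nth x lti; rewrite mem_enum inE.
Qed.

Lemma nth_out_nbrs x v i : i < outdeg e v ->
  e v (nth x (out_nbrs v) i) /\ index (nth x (out_nbrs v) i) (out_nbrs v) = i.
Proof.
rewrite /outdeg cardE => lti; rewrite index_uniq ?enum_uniq //; split=> //.
by have := mem_nth x lti; rewrite mem_enum inE.
Qed.

Definition shift_pairing v k u w :=
  [&& e u v, e v w & index w (out_nbrs v) == (index u (in_nbrs v) + k) %% M v].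

Lemma shift_pairing_fun v k u w w' :
  shift_pairing v k u w -> shift_pairing v k u w' -> w = w'.
Proof.
case/and3P=> _ evw /eqP iw /and3P[_ evw' /eqP iw'].
by apply: (@index_inj _ w (out_nbrs v)); rewrite ?mem_enum ?inE ?iw.
Qed.

Lemma shift_pairing_inj v k u u' w :
  shift_pairing v k u w -> shift_pairing v k u' w -> u = u'.
Proof.
case/and3P=> euv _ /eqP iw /and3P[eu'v _]; rewrite iw.
rewrite eqn_modDr !modn_small; last first.
- by apply: leq_trans (index_in_nbrs _) (leq_maxr _ _).
- by apply: leq_trans (index_in_nbrs _) (leq_maxr _ _).
by move/eqP; apply: (index_inj u); rewrite mem_enum inE.
Qed.

Lemma shift_pairing_in v k u : indeg e v <= outdeg e v -> e u v ->
  exists w, shift_pairing v k u w.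
Proof.
move=> le euv; have ME : M v = outdeg e v by apply/maxn_idPl.
have out0 : 0 < outdeg e v.
  by apply: leq_trans le; apply: leq_ltn_trans (index_in_nbrs euv).
have [] := @nth_out_nbrs u v ((index u (in_nbrs v) + k) %% M v).
  by rewrite ME ltn_mod.
set w := nth _ _ _ => evw idx; exists w.
by rewrite /shift_pairing euv evw idx /=.
Qed.

Lemma shift_pairing_out v k w : outdeg e v <= indeg e v -> e v w ->
  exists u, shift_pairing v k u w.
Proof.
move=> le evw; have ME : M v = indeg e v by apply/maxn_idPr.
have in0 : 0 < indeg e v.
  by apply: leq_trans le; apply: leq_ltn_trans (index_out_nbrs evw).
pose j := index w (out_nbrs v).
(* The partner of [w] has index [j - k] modulo [M v], written so as to avoid truncated
   subtraction. *)
have [] := @nth_in_nbrs w v ((j + (M v - k %% M v)) %% M v).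
  by rewrite ME ltn_mod.
set u := nth _ _ _ => euv idx; exists u.
rewrite /shift_pairing euv evw idx /= modnDml -/j eq_sym.
rewrite -modnDmr -addnA subnK; last by rewrite ltnW // ltn_mod ME.
rewrite modnDr modn_small // ME.
exact: leq_trans (index_out_nbrs evw) le.
Qed.

(* The shifts range over ['I_(d`!)] because [d`!] is a common multiple of all *)
(* the [M v], which makes them equidistributed modulo each [M v].             *)
Lemma card_shift_pairing d v u w : M v <= d ->
  #|[set k : 'I_(d`!) | shift_pairing v k u w]| * M v <= d`!.
Proof.
move=> Md; have [->|M0] := posnP (M v); first by rewrite muln0.
(* The shifts counted lie in one residue class modulo [M v], so the quotient [k %/ M v] tells them
   apart. *)
have dvdM : M v %| d`! by rewrite dvdn_fact ?M0.
rewrite -leq_divRL // cardE -(size_map (fun k : 'I__ => k %/ M v)).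
rewrite -[X in _ <= X](size_iota 0); apply: uniq_leq_size.
  rewrite map_inj_in_uniq ?enum_uniq // => k k'.
  rewrite !mem_enum !inE => /and3P[_ _ /eqP iw] /and3P[_ _].
  rewrite iw eqn_modDl => /eqP modE divE; apply: val_inj => /=.
  by rewrite (divn_eq k (M v)) divE modE -divn_eq.
move=> i /mapP[k _ ->]; rewrite mem_iota add0n /=.
by rewrite ltn_divLR // divnK.
Qed.

End ShiftPairing.

Local Open Scope ring_scope.

(** * Weights of directed cycles *)

Lemma big_tuple_cons (R : nmodType) (T : finType) n (P : pred (seq T))
    (F : seq T -> R) :
  \sum_(t : n.+1.-tuple T | P t) F t =
  \sum_x \sum_(t : n.-tuple T | P (x :: t)) F (x :: t).
Proof.
rewrite pair_big_dep /=.
rewrite (reindex (fun z : T * n.-tuple T => [tuple of z.1 :: z.2])) //=.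
exists (fun t : n.+1.-tuple T => (thead t, [tuple of behead t])).
  by move=> [x t] _; congr pair; apply: val_inj.
by move=> t _; rewrite /= -tuple_eta.
Qed.

Section WalkSums.
Variables (R : realFieldType) (T : finType) (e : rel T) (f : T -> R).
Hypothesis f_ge0 : forall x, 0 <= f x.
Hypothesis f_le1 : forall x, f x <= 1.

Lemma prod_walk_ge0 (c : seq T) : 0 <= \prod_(u <- c) f u.
Proof. by apply: prodr_ge0. Qed.

(** With [f] the reciprocal outdegree these are the probabilities of the trajectories of a random
    walk from [x]; the last vertex makes no step, hence [belast]. *)
Lemma sum_walks (f_out : forall x, \sum_(y | e x y) f x <= 1) n x :
  \sum_(t : n.-tuple T | path e x t) \prod_(u <- belast x t) f u <= 1.
Proof.
elim: n x => [|n IHn] x.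
  rewrite (big_pred1 [tuple]) => [|t]; last by rewrite [t]tuple0 /=; apply/esym/eqP.
  by rewrite /= big_nil.
rewrite (big_tuple_cons n (fun t => path e x t)
  (fun t => \prod_(u <- belast x t) f u)).
rewrite /= (bigID (e x)) /= [X in _ + X]big1 ?addr0 => [|y /negPf exy]; last first.
  by rewrite big_pred0 // => t; rewrite exy.
apply: le_trans (f_out x); apply: ler_sum => y exy; rewrite exy /=.
under eq_bigr do rewrite big_cons.
by rewrite -mulr_sumr ler_piMr.
Qed.

(** The closing edge is forgotten and its factor bounded by 1. *)
Lemma sum_cycles_out (f_out : forall x, \sum_(y | e x y) f x <= 1) n x :
  \sum_(t : n.-tuple T | cycle e (x :: t)) \prod_(u <- x :: t) f u <= 1.
Proof.
apply: le_trans (sum_walks f_out n x).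
rewrite big_mkcond [leRHS]big_mkcond /=; apply: ler_sum => t _.
rewrite rcons_path; case: (path e x t) => //=.
have le : \prod_(u <- x :: t) f u <= \prod_(u <- belast x t) f u.
  by rewrite lastI -cats1 big_cat big_seq1 /= ler_piMr ?prod_walk_ge0.
by case: ifP => // _; apply: le_trans le; apply: prod_walk_ge0.
Qed.

End WalkSums.

(** Reversing a closed walk gives a closed walk of the reverse digraph. *)
Lemma sum_cycles_in (R : realFieldType) (T : finType) (e : rel T) (f : T -> R)
    (f_ge0 : forall x, 0 <= f x) (f_le1 : forall x, f x <= 1)
    (f_in : forall x, \sum_(y | e y x) f x <= 1) n x :
  \sum_(t : n.-tuple T | cycle e (x :: t)) \prod_(u <- x :: t) f u <= 1.
Proof.
have revK : involutive (fun t : n.-tuple T => [tuple of rev t]).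
  by move=> t; apply: val_inj; rewrite /= revK.
rewrite (reindex_inj (inv_inj revK)) /=.
apply: le_trans (sum_cycles_out f_ge0 f_le1 (e := fun x y => e y x) f_in n x).
rewrite le_eqVlt; apply/orP; left; apply/eqP; apply: eq_big => [t|t _].
  rewrite -[path _ _ _]/(cycle e (x :: rev t)) -[RHS]/(cycle _ (x :: t)).
  by rewrite -[LHS](rot_cycle 1) rot1_cons -rev_cons rev_cycle.
by apply: perm_big; rewrite perm_cons perm_rev.
Qed.

Section CycleWeights.
Variables (R : realFieldType) (T : finType) (e : rel T) (d : nat) (r : R).
Hypothesis d_max : (Delta0 e <= d)%N.
Hypothesis unbalanced : forall v, exv e v <> 0%N.
Hypothesis r_ge0 : 0 <= r.
Hypothesis r_d : 1 - d%:R^-1 <= r ^+ 4.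

Definition cycle_weight (c : seq T) : R := \prod_(u <- c) (maxdeg e u)%:R^-1.

Lemma maxdeg_le v : (maxdeg e v <= d)%N.
Proof. by apply: leq_trans d_max; apply: leq_bigmax. Qed.

(** For a < b <= d the claim amounts to a/b <= r^4, and a/b <= 1 - 1/b <= 1 - 1/d. *)
Lemma inv_maxn_sqr (a b : nat) : (0 < a)%N -> (0 < b)%N -> a != b ->
  (maxn a b <= d)%N ->
  (maxn a b)%:R^-1 ^+ 2 <= r ^+ 4 * (a%:R^-1 * b%:R^-1) :> R.
Proof.
wlog ltab : a b / (a < b)%N => [wl a0 b0 ab|a0 b0 _].
  move: (ab); rewrite neq_ltn => /orP[/wl|/wl ba]; first exact.
  by rewrite maxnC [a%:R^-1 * _]mulrC; apply: ba; rewrite // eq_sym.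
rewrite (maxn_idPr (ltnW ltab)) => led.
rewrite expr2 mulrA ler_wpM2r ?invr_ge0 // ler_pdivlMr ?ltr0n //.
apply: le_trans r_d; rewrite mulrC ler_pdivrMr ?ltr0n // mulrBl mul1r.
rewrite lerBrDr; apply: le_trans (_ : a%:R + 1 <= _); last first.
  by rewrite natr1 ler_nat.
rewrite lerD2l mulrC ler_pdivrMr ?mul1r ?ler_nat // ltr0n.
exact: leq_trans b0 led.
Qed.

Lemma cycle_deg_gt0 c u : cycle e c -> u \in c ->
  (0 < outdeg e u)%N && (0 < indeg e u)%N.
Proof.
move=> ec uc; apply/andP; split; apply/card_gt0P.
  by exists (next c u); rewrite inE next_cycle.
by exists (prev c u); rewrite inE prev_cycle.
Qed.

(** Multiplying [inv_maxn_sqr] along the cycle bounds the squared weight by r^(4l) F G, with F and G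
    the two products; then F G <= (F + G)^2. *)
Lemma cycle_weight_le (c : seq T) : cycle e c ->
  cycle_weight c <= r ^+ (size c).*2 *
    (\prod_(u <- c) (outdeg e u)%:R^-1 + \prod_(u <- c) (indeg e u)%:R^-1).
Proof.
move=> ec; set F := \prod_(u <- c) _; set G := \prod_(u <- c) _.
have F0 : 0 <= F by apply: prodr_ge0 => u _; rewrite invr_ge0.
have G0 : 0 <= G by apply: prodr_ge0 => u _; rewrite invr_ge0.
have W0 : 0 <= cycle_weight c by apply: prodr_ge0 => u _; rewrite invr_ge0.
rewrite -ler_sqr ?nnegrE ?mulr_ge0 ?exprn_ge0 ?addr_ge0 //.
have le : cycle_weight c ^+ 2 <= (r ^+ (size c).*2) ^+ 2 * (F * G).
  have -> : (r ^+ (size c).*2) ^+ 2 = \prod_(u <- c) r ^+ 4.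
    rewrite big_const_seq iter_mulr_1 count_predT -!exprM; congr (_ ^+ _).
    by rewrite -muln2 -mulnA mulnC.
  rewrite -!big_split -prodrXl /= !big_seq; apply: ler_prod => u uc.
  rewrite sqr_ge0; have /andP[out0 in0] := cycle_deg_gt0 ec uc.
  apply: inv_maxn_sqr => //; last exact: maxdeg_le.
  by apply/eqP => oi; apply: (@unbalanced u); rewrite /exv oi distnn.
apply: le_trans le _; rewrite [leRHS]exprMn ler_wpM2l ?exprn_ge0 //.
by rewrite sqrrD; nra.
Qed.

Lemma sum_cycle_weight n x :
  \sum_(t : n.-tuple T | cycle e (x :: t)) cycle_weight (x :: t) <= 2 * r ^+ n.+1.*2.
Proof.
have inv_le1 m : m%:R^-1 <= 1 :> R.
  by case: m => [|m]; rewrite ?invr0 // invf_le1 ?ler1n ?ltr0n.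
have inv_ge0 m : 0 <= m%:R^-1 :> R by rewrite invr_ge0.
have sum_inv m : m%:R^-1 *+ m <= 1 :> R.
  case: m => [|m]; first by rewrite mulr0n.
  by rewrite -[_ *+ _]mulr_natr mulVf // pnatr_eq0.
have outP y : \sum_(z | e y z) (outdeg e y)%:R^-1 <= 1 :> R.
  by rewrite sumr_const; apply: le_trans (sum_inv (outdeg e y)); rewrite /outdeg cardsE.
have inP y : \sum_(z | e z y) (indeg e y)%:R^-1 <= 1 :> R.
  by rewrite sumr_const; apply: le_trans (sum_inv (indeg e y)); rewrite /indeg cardsE.
have Fle := sum_cycles_out (fun y => inv_ge0 (outdeg e y)) (fun y => inv_le1 _) outP n x.
have Gle := sum_cycles_in (fun y => inv_ge0 (indeg e y)) (fun y => inv_le1 _) inP n x.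
apply: le_trans (_ : r ^+ n.+1.*2 * (1 + 1) <= _); last by rewrite mulrC.
apply: le_trans (ler_wpM2l (exprn_ge0 _ r_ge0) (lerD Fle Gle)).
rewrite -big_split mulr_sumr /=; apply: ler_sum => t ct.
by apply: le_trans (cycle_weight_le (c := x :: t) ct) _; rewrite /= size_tuple.
Qed.

Lemma cycle_weight_rot k c : cycle_weight (rot k c) = cycle_weight c.
Proof. by apply: perm_big; rewrite perm_rot. Qed.

(** There are [n] positions for [v]; rotating each to the front reduces to cycles that start at
    [v]. *)
Lemma sum_cycle_weight_through n v :
  \sum_(t : n.-tuple T | cycle e t && (v \in t)) cycle_weight t <=
  n%:R * (2 * r ^+ n.*2).
Proof.
have W0 c : 0 <= cycle_weight c by apply: prodr_ge0 => u _; rewrite invr_ge0.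
case: n => [|n].
  by rewrite big1 ?mul0r // => t; rewrite [t]tuple0 andbF.
apply: le_trans (_ : \sum_(k < n.+1) \sum_(t : n.+1.-tuple T |
  cycle e t && (nth v t k == v)) cycle_weight t <= _).
  rewrite (exchange_big_dep (fun t : n.+1.-tuple T => cycle e t)) /=; last first.
    by move=> k t _ /andP[].
  rewrite big_mkcondr; apply: ler_sum => t ct; rewrite ct.
  case: ifP => [vt|_]; last exact: sumr_ge0.
  have kP : (index v t < n.+1)%N by rewrite -[X in (_ < X)%N](size_tuple t) index_mem.
  rewrite (bigD1 (Ordinal kP)) /= ?nth_index ?eqxx // lerDl.
  exact: sumr_ge0.
rewrite mulr_natl -[X in _ *+ X]card_ord -sumr_const; apply: ler_sum => k _.
apply: le_trans (sum_cycle_weight n v).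
have rotI : injective (fun t : n.+1.-tuple T => [tuple of rot k t]).
  by move=> t t' /(congr1 val) /= /rot_inj /val_inj.
have -> : \sum_(t : n.-tuple T | cycle e (v :: t)) cycle_weight (v :: t) =
    \sum_(t : n.+1.-tuple T | cycle e t && (head v t == v)) cycle_weight t.
  rewrite (big_tuple_cons n (fun t => cycle e t && (head v t == v)) cycle_weight).
  rewrite (bigD1 v) //= [X in _ = _ + X]big1 ?addr0 => [|x /negPf xv].
    by apply: eq_bigl => t; rewrite eqxx andbT.
  by rewrite big_pred0 // => t; rewrite xv andbF.
rewrite [leRHS](reindex_inj rotI) /=.
rewrite le_eqVlt; apply/orP; left; apply/eqP; apply: eq_big => [t|t _].
  rewrite rot_cycle; congr (_ && (_ == _)).
  by rewrite /rot (drop_nth v) // size_tuple.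
by rewrite cycle_weight_rot.
Qed.

End CycleWeights.

(** * Numerical estimates for the ratio r = 1 - 1/(4d) *)

Lemma bernoulli (R : realFieldType) (x : R) n : 0 <= x -> 1 + n%:R * x <= (1 + x) ^+ n.
Proof.
move=> x0; elim: n => [|n IHn]; first by rewrite mul0r addr0.
rewrite exprS; apply: le_trans (ler_wpM2l _ IHn); last by rewrite addr_ge0.
have : 0 <= n%:R * x * x by rewrite !mulr_ge0.
by rewrite -natr1; nra.
Qed.

(** Here a = 1/(1 - r), and the infinite tail is r^L (L a + r a^2). The cruder bound exceeds its
    first term plus the bound at [L.+1] by exactly r^L. *)
Lemma sum_natr_geometric (R : realFieldType) (a r : R) L N : 0 <= r -> (1 - r) * a = 1 ->
    0 <= a ->
  \sum_(L <= n < L + N) n%:R * r ^+ n <= r ^+ L * (L%:R * a + a ^+ 2).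
Proof.
move=> r0 ra a0; elim: N L => [|N IHN] L.
  by rewrite addn0 big_geq // mulr_ge0 ?exprn_ge0 // addr_ge0 ?mulr_ge0 ?sqr_ge0.
rewrite big_ltn ?addnS ?ltnS ?leq_addr // -addSn.
apply: le_trans (lerD (lexx _) (IHN L.+1)) _.
rewrite exprS -natr1; have : 0 <= r ^+ L by rewrite exprn_ge0.
move: (r ^+ L) (L%:R) => y l y0.
have -> : y * (l * a + a ^+ 2) = l * y + r * y * ((l + 1) * a + a ^+ 2) + y.
  apply/eqP; rewrite -subr_eq0; apply/eqP.
  transitivity (y * (l + a + 1) * ((1 - r) * a - 1)); first by ring.
  by rewrite ra subrr mulr0.
by rewrite lerDl.
Qed.

Section Numerics.
Variables (R : realFieldType) (d : nat).
Hypothesis d_gt0 : (0 < d)%N.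
Let D : R := d%:R.
Let r : R := 1 - (4 * D)^-1.

Let D_ge1 : 1 <= D. Proof. by rewrite ler1n. Qed.
Let D4_gt0 : 0 < 4 * D. Proof. by move: D_ge1; lra. Qed.
Let x_gt0 : 0 < (4 * D)^-1. Proof. by rewrite invr_gt0. Qed.
Let x_le : (4 * D)^-1 <= 4^-1.
Proof. by rewrite lef_pV2 ?posrE ?ltr0n //; move: D_ge1; lra. Qed.

Lemma ratio_gt0 : 0 < r.
Proof. by rewrite /r; move: x_gt0 x_le; lra. Qed.

Lemma ratio_pow4 : 1 - D^-1 <= r ^+ 4.
Proof.
have D0 : D != 0 by rewrite pnatr_eq0 -lt0n.
have -> : D^-1 = 4 * (4 * D)^-1 by field.
rewrite /r; move: x_gt0 x_le; move: (4 * D)^-1 => x x0 x1.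
have -> : (1 - x) ^+ 4 = 1 - 4 * x + x ^+ 2 * (6 - 4 * x + x ^+ 2) by ring.
have := sqr_ge0 x; move: (x ^+ 2) => z z0.
by rewrite lerDl mulr_ge0 //; lra.
Qed.

(** With x = 1/(4d), (1 - x)(1 + x) <= 1, while (1 + x)^(4d) >= 2 by Bernoulli. *)
Lemma ratio_pow_half : r ^+ (4 * d) <= 2^-1.
Proof.
have le2 : 2 <= (1 + (4 * D)^-1) ^+ (4 * d).
  apply: le_trans (bernoulli _ (ltW x_gt0)).
  by rewrite (natrM _ 4) -/D divff ?lt0r_neq0.
have le1 : r ^+ (4 * d) * (1 + (4 * D)^-1) ^+ (4 * d) <= 1.
  have r0 := ratio_gt0; rewrite -exprMn; apply: exprn_ile1.
    by rewrite mulr_ge0 ?(ltW r0) //; move: x_gt0; lra.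
  by rewrite /r; nra.
rewrite -[leRHS]mul1r ler_pdivlMr ?ltr0n //; apply: le_trans le1.
rewrite ler_wpM2l //; apply: exprn_ge0; exact: (ltW ratio_gt0).
Qed.

(** The left side is 8 D^2 (4 D L + 16 D^2) for L = 200 D^2, the factor to be beaten in
    [tail_bound]. With y = 2^d >= D it is at most 6528 y^5 <= y^21. *)
Lemma poly_le_exp : 6400 * D ^+ 5 + 128 * D ^+ 4 <= 2 ^+ (50 * d).
Proof.
rewrite mulnC exprM; set y : R := 2 ^+ d.
have Dy : D <= y by rewrite /y -natrX ler_nat ltnW // ltn_expl.
have y2 : 2 <= y by rewrite /y -[leLHS]expr1 ler_weXn2l ?ler1n.
have y1 : 1 <= y by lra.
have y0 : 0 <= y by lra.
have D1 := D_ge1; have D0 : 0 <= D by lra.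
have D5 : D ^+ 5 <= y ^+ 5 by rewrite lerXn2r ?nnegrE.
have D4 : D ^+ 4 <= D ^+ 5 by rewrite ler_weXn2l.
have y4 : 16 <= y ^+ 4.
  have -> : y ^+ 4 = (y * y) * (y * y) by ring.
  have yy : 4 <= y * y by nra.
  by move: (y * y) yy => z z4; nra.
have y16 : 6528 <= y ^+ 16.
  rewrite (exprM y 4 4); move: (y ^+ 4) y4 => z z16.
  have -> : z ^+ 4 = (z * z) * (z * z) by ring.
  have zz : 256 <= z * z by nra.
  by move: (z * z) zz => t t256; nra.
have y5 : 0 <= y ^+ 5 by rewrite exprn_ge0.
apply: le_trans (_ : y ^+ 16 * y ^+ 5 <= _).
  apply: le_trans (ler_wpM2r y5 y16).
  by move: (D ^+ 4) (D ^+ 5) (y ^+ 5) D4 D5 => u w z D4 D5; lra.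
by rewrite -exprD ler_weXn2l.
Qed.

Lemma tail_bound N : \sum_(200 * d ^ 2 <= n < 200 * d ^ 2 + N)
   2 * D * (n%:R * r ^+ n) <= 1 - r.
Proof.
have r0 := ltW ratio_gt0.
have D0 : D != 0 by rewrite pnatr_eq0 -lt0n.
have D_ge0 : 0 <= D by move: D_ge1; lra.
have ra : (1 - r) * (4 * D) = 1 by rewrite /r; field.
rewrite -mulr_sumr.
have D2 : 0 <= 2 * D by lra.
apply: le_trans (ler_wpM2l D2 (sum_natr_geometric _ _ r0 ra (ltW D4_gt0))) _.
have -> : 1 - r = (4 * D)^-1 by rewrite /r; ring.
have LE : (200 * d ^ 2 = (4 * d) * (50 * d))%N by rewrite [RHS]mulnACA mulnn.
have powL : r ^+ (200 * d ^ 2) <= (2 ^+ (50 * d))^-1.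
  rewrite LE exprM -exprVn; apply: lerXn2r; rewrite ?nnegrE ?exprn_ge0 //.
    by rewrite invr_ge0 ler0n.
  exact: ratio_pow_half.
rewrite (natrM _ 200) natrX -/D -[leRHS]mul1r ler_pdivlMr //.
apply: le_trans (_ : r ^+ (200 * d ^ 2) * 2 ^+ (50 * d) <= _).
  apply: le_trans (ler_wpM2l (exprn_ge0 _ r0) poly_le_exp).
  move: (r ^+ (200 * d ^ 2)) => z.
  by rewrite le_eqVlt; apply/orP; left; apply/eqP; ring.
by rewrite -ler_pdivlMr ?mul1r // exprn_gt0 // ltr0n.
Qed.

End Numerics.

(** * Shifts that follow no directed cycle *)

Section GoodShift.
Variables (d : nat) (T : finType) (e : rel T).
Hypothesis e_irr : irreflexive e.
Hypothesis d_max : (Delta0 e <= d)%N.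
Hypothesis long_cycles : forall c, dicycle e c -> (200 * d ^ 2 <= size c)%N.
Hypothesis unbalanced : forall v, exv e v <> 0%N.

Notation L := (200 * d ^ 2)%N.
Let r : rat := 1 - (4 * d%:R)^-1.

Definition bad_cycles : seq (seq T) :=
  flatten [seq map val [seq t <- index_enum (n.-tuple T) | dicycle e (val t)]
          | n <- index_iota L (L + #|T|.+1)].
(** The head of [c] is the exempt vertex, so the rotations of a cycle are separate events. *)
Definition bad_support (c : seq T) := [set u in behead c].
Definition bad_shifts (c : seq T) (u : T) :=
  [set k : 'I_(d`!) | shift_pairing e u k (prev c u) (next c u)].

Lemma mem_bad_cycles c : dicycle e c -> c \in bad_cycles.
Proof.
move=> cP; apply/flatten_mapP; exists (size c).
  by rewrite mem_index_iota long_cycles // ltn_addl // ltnS (dicycle_size cP).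
by apply/mapP; exists (in_tuple c); rewrite // mem_filter cP mem_index_enum.
Qed.

Lemma bad_cycles_dicycle c : c \in bad_cycles -> dicycle e c.
Proof. by case/flatten_mapP=> n _ /mapP[t]; rewrite mem_filter => /andP[tP _] ->. Qed.

Lemma bad_support_neq0 c : dicycle e c -> bad_support c != set0.
Proof.
case: c => [|x [|y c]] //; first by rewrite /dicycle /ucycleb /= e_irr.
by move=> _; apply/set0Pn; exists y; rewrite !inE eqxx.
Qed.

Lemma unbalanced_gt0 : T -> (0 < d)%N.
Proof.
move=> v; apply: leq_trans (maxdeg_le d_max v); rewrite lt0n; apply/eqP => m0.
apply: (@unbalanced v); rewrite /exv.
have : (outdeg e v <= 0)%N by rewrite -m0 leq_maxl.
have : (indeg e v <= 0)%N by rewrite -m0 leq_maxr.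
by rewrite !leqn0 => /eqP -> /eqP ->.
Qed.

(** The event imposes nothing at the head; the factor [d] makes up for the missing 1/M <= 1
    there. *)
Lemma bad_weight_le c : dicycle e c ->
  event_weight rat bad_support bad_shifts c <= d%:R * cycle_weight rat e c.
Proof.
case: c => [//|x p] /and3P[_ ec /= /andP[_ Up]].
have M0 u : u \in x :: p -> (0 < maxdeg e u)%N.
  by move=> /(cycle_deg_gt0 ec) /andP[out0 _]; apply: leq_trans out0 (leq_maxl _ _).
apply: le_trans (_ : cycle_weight rat e p <= _); last first.
  rewrite /cycle_weight big_cons mulrA ler_peMl //.
    by apply: prodr_ge0 => u _; rewrite invr_ge0.
  by rewrite ler_pdivlMr ?ltr0n ?M0 ?mem_head // mul1r ler_nat maxdeg_le.
rewrite /event_weight /cycle_weight (big_uniq _ Up) /=.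
rewrite (eq_bigl [in p]) => [|u]; last by rewrite inE.
apply: ler_prod => u up; rewrite mulr_ge0 ?invr_ge0 //=.
rewrite card_ord ler_pdivrMr ?ltr0n ?fact_gt0 // mulrC.
rewrite ler_pdivlMr ?ltr0n ?M0 ?inE ?up ?orbT // -natrM ler_nat.
exact: card_shift_pairing (maxdeg_le d_max u).
Qed.

(** Cycles of length [n] contribute at most d (2 n r^(2n)) r^-n, the term of [tail_bound]; supports
    have at most [n] elements and r <= 1. *)
Lemma bad_local_sum v :
  \sum_(c <- bad_cycles | v \in bad_support c)
    event_weight rat bad_support bad_shifts c * r ^- #|bad_support c| <= 1 - r.
Proof.
have d_gt0 := unbalanced_gt0 v.
have r_gt0 : 0 < r := ratio_gt0 rat d_gt0.
have r_le1 : r <= 1 by rewrite /r gerBl invr_ge0 mulr_ge0.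
apply: le_trans (tail_bound rat d_gt0 #|T|.+1); rewrite -/r.
rewrite big_flatten big_map; apply: ler_sum => n _.
rewrite big_map big_filter_cond /=.
apply: le_trans (_ : \sum_(t : n.-tuple T | cycle e t && (v \in t))
    d%:R * cycle_weight rat e t * r ^- n <= _).
  rewrite big_mkcond [leRHS]big_mkcond /=; apply: ler_sum => t _.
  have W0 : 0 <= cycle_weight rat e t by apply: prodr_ge0 => u _; rewrite invr_ge0.
  have rhs0 : 0 <= d%:R * cycle_weight rat e t * r ^- n.
    by rewrite !mulr_ge0 // invr_ge0 exprn_ge0 // ltW.
  case: ifP => [/andP[tP]|_]; last by case: ifP.
  rewrite inE => /mem_behead vt; have /and3P[_ ct _] := tP; rewrite ct vt.
  apply: ler_pM.
  - exact: event_weight_ge0.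
  - by rewrite invr_ge0 exprn_ge0 // ltW.
  - exact: bad_weight_le.
  rewrite lef_pV2 ?posrE ?exprn_gt0 //; apply: ler_wiXn2l; rewrite ?(ltW r_gt0) //.
  rewrite cardsE; apply: leq_trans (card_size _) _.
  by rewrite size_behead size_tuple leq_pred.
rewrite -mulr_suml -mulr_sumr.
have le := sum_cycle_weight_through d_max unbalanced (ltW r_gt0) (ratio_pow4 rat d_gt0) n v.
rewrite -/r in le.
apply: le_trans (_ : d%:R * (n%:R * (2 * r ^+ n.*2)) * r ^- n <= _).
  by rewrite ler_wpM2r ?invr_ge0 ?exprn_ge0 ?(ltW r_gt0) // ler_wpM2l.
have rn0 : r ^+ n != 0 by rewrite expf_neq0 // lt0r_neq0.
rewrite -addnn exprD le_eqVlt; apply/orP; left; apply/eqP.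
by move: (r ^+ n) rn0 => z z0; field.
Qed.

Lemma exists_good_shift : exists w : {ffun T -> 'I_(d`!)}, forall c, dicycle e c ->
  ~ forall u, u \in behead c -> shift_pairing e u (w u) (prev c u) (next c u).
Proof.
have X0 : (0 < #|'I_(d`!)|)%N by rewrite card_ord fact_gt0.
have r_gt0 : 0 < r.
  (* For [d = 0] the convention that 0 has inverse 0 gives r = 1. *)
  have [d0|d_gt0] := posnP d; last exact: (ratio_gt0 rat d_gt0).
  by rewrite /r d0 mulr0 invr0 subr0.
have [w wP] := exists_avoiding X0 r_gt0
  (fun c cs => bad_support_neq0 (bad_cycles_dicycle cs)) bad_local_sum.
exists w => c cP occ; move/negP: (wP c (mem_bad_cycles cP)); apply.
by apply/forall_inP => u; rewrite !inE => /occ.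
Qed.

End GoodShift.

Local Close Scope ring_scope.

Theorem theorem3p1 (d : nat) (T : finType) (e : rel T)
  (e_irr : irreflexive e)
  (hDelta : Delta0 e <= d)
  (hgirth : girth_ge e (200 * d ^ 2))
  (hex : forall v : T, exv e v <> 0) :
  consistent e.
Proof.
have long c : dicycle e c -> 200 * d ^ 2 <= size c.
  move=> cP; move: hgirth; rewrite /girth_ge; case E: (girth e) => [g|].
    by move=> /leq_trans -> //; have [_ /(_ c cP)] := (girth_SomeP e g).1 E.
  by have := (girth_NoneP e).1 E c; rewrite cP.
have [w wP] := exists_good_shift e_irr hDelta long hex.
apply: (@pairing_consistent _ _ (fun v => shift_pairing e v (w v))) => //.
- by move=> v u x /and3P[-> ->].
- by move=> v u x x'; apply: shift_pairing_fun.
- by move=> v u u' x; apply: shift_pairing_inj.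
- by move=> v u; apply: shift_pairing_in.
- by move=> v x; apply: shift_pairing_out.
Qed.
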